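(* Let $\mathcal{Z}\subset\mathbb{R}^d$ be a convex compact set with $\max_{\mathbf{z},\mathbf{z}'\in\mathcal{Z}}\|\mathbf{z}-\mathbf{z}'\|\le D$, let $\rho>0$, and let $F:\mathcal{Z}\rightrightarrows\mathbb{R}^d$ be a $\rho$-weakly monotone set-valued mapping such that $\mathrm{MVI}(F,\mathcal{Z})$ has a solution. Set $\gamma=\frac{1}{2\rho}$, fix $\alpha\ge 1$, an integer $K\ge1$, and weights $\theta_k=(k+1)^\alpha$. Let $\mathbf{z}_0\in\mathcal{Z}$ and let $\mathbf{z}_1,\dots,\mathbf{z}_K\in\mathcal{Z}$ be (possibly random) points generated sequentially by the inexact proximal point method: for $k=0,\dots,K-1$, with $F_k(\mathbf{z}):=F(\mathbf{z})+\gamma^{-1}(\mathbf{z}-\mathbf{z}_k)$, the point $\mathbf{z}_{k+1}$ is the output of a subroutine $\mathrm{ApproxSVI}(F_k,\mathcal{Z},\mathbf{z}_k,\eta_k,T_k)$. Suppose there is a constant $c>0$ such that for every $k=0,1,\dots,K-1$ there exists $\boldsymbol{\xi}_{k+1}\in F_k(\mathbf{z}_{k+1})$ with $$\max_{\mathbf{z}\in\mathcal{Z}}\mathbb{E}\big[\boldsymbol{\xi}_{k+1}^{\top}(\mathbf{z}_{k+1}-\mathbf{z})\,\big|\,\mathbf{z}_k\big]\le \frac{c}{k+1},$$ where $\mathbb{E}[\cdot\mid\mathbf{z}_k]$ is the conditional expectation conditioning on $\mathbf{z}_k$. Let $\tau\in\{0,1,\dots,K-1\}$ be drawn with $\mathrm{Prob}(\tau=k)=\theta_k/\sum_{l=0}^{K-1}\theta_l$,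 and let $\bar{\mathbf{z}}_\tau$ be the unique solution of $\mathrm{SVI}(F^\gamma_{\mathbf{z}_\tau},\mathcal{Z})$, where $F^\gamma_{\mathbf{w}}(\mathbf{z}):=F(\mathbf{z})+\gamma^{-1}(\mathbf{z}-\mathbf{w})$. Then $$\mathbb{E}\big[\|\mathbf{z}_\tau-\bar{\mathbf{z}}_\tau\|^2\big]\le \frac{2D^2(\alpha+1)}{K}+\frac{4c(\alpha+1)}{K\rho}.$$
   Context: $\|\cdot\|$ is the Euclidean norm. A set-valued mapping $F:\mathcal{Z}\rightrightarrows\mathbb{R}^d$ is $\rho$-weakly monotone if $\langle\boldsymbol{\xi}-\boldsymbol{\xi}',\mathbf{z}-\mathbf{z}'\rangle\ge-\rho\|\mathbf{z}-\mathbf{z}'\|^2$ for all $\mathbf{z},\mathbf{z}'\in\mathcal{Z}$, $\boldsymbol{\xi}\in F(\mathbf{z})$, $\boldsymbol{\xi}'\in F(\mathbf{z}')$; it is $\mu$-strongly monotone if the same holds with right-hand side $\mu\|\mathbf{z}-\mathbf{z}'\|^2$. $\mathrm{SVI}(F,\mathcal{Z})$ is the problem of finding $\mathbf{z}^*\in\mathcal{Z}$ such that there is $\boldsymbol{\xi}^*\in F(\mathbf{z}^* )$ with $\langle\boldsymbol{\xi}^*,\mathbf{z}-\mathbf{z}^*\rangle\ge0$ for all $\mathbf{z}\in\mathcal{Z}$. $\mathrm{MVI}(F,\mathcal{Z})$ is the problem of finding $\mathbf{z}_*\in\mathcal{Z}$ such that $\langle\boldsymbol{\xi},\mathbf{z}-\mathbf{z}_*\rangle\ge0$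 for all $\mathbf{z}\in\mathcal{Z}$ and all $\boldsymbol{\xi}\in F(\mathbf{z})$. For $0<\gamma<\rho^{-1}$ the mapping $F^\gamma_{\mathbf{w}}$ is $(\gamma^{-1}-\rho)$-strongly monotone, so $\mathrm{SVI}(F^\gamma_{\mathbf{w}},\mathcal{Z})$ has a unique solution. Expectations are over all randomness of the subroutines and of $\tau$. *)

(* Defs.v *)
From HB Require Import structures.
From mathcomp Require Import all_boot all_order all_algebra.
From mathcomp Require Import all_classical all_reals all_analysis.
Set Implicit Arguments. Unset Strict Implicit. Unset Printing Implicit Defensive.
Import Order.TTheory GRing.Theory Num.Theory.
Import numFieldNormedType.Exports.
Local Open Scope classical_set_scope.
Local Open Scope ring_scope.

Section Defs.
Context {R : realType} {n : nat}.

Definition dotv (u v : 'rV[R]_n) : R := \sum_(i < n) u ord0 i * v ord0 i.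
Definition enorm (u : 'rV[R]_n) : R := Num.sqrt (dotv u u).

Definition diam_le (Z : set 'rV[R]_n) (D : R) : Prop :=
  forall z z', Z z -> Z z' -> enorm (z - z') <= D.

Definition weakly_monotone (F : 'rV[R]_n -> set 'rV[R]_n) (Z : set 'rV[R]_n)
  (rho : R) : Prop :=
  forall z z' xi xi', Z z -> Z z' -> F z xi -> F z' xi' ->
    - rho * enorm (z - z') ^+ 2 <= dotv (xi - xi') (z - z').

Definition is_MVI_sol (F : 'rV[R]_n -> set 'rV[R]_n) (Z : set 'rV[R]_n)
  (zs : 'rV[R]_n) : Prop :=
  Z zs /\ forall z xi, Z z -> F z xi -> 0 <= dotv xi (z - zs).

Definition is_SVI_sol (F : 'rV[R]_n -> set 'rV[R]_n) (Z : set 'rV[R]_n)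
  (zs : 'rV[R]_n) : Prop :=
  Z zs /\ exists2 xi, F zs xi & forall z, Z z -> 0 <= dotv xi (z - zs).

Definition prox_op (F : 'rV[R]_n -> set 'rV[R]_n) (gamma : R) (w : 'rV[R]_n)
  : 'rV[R]_n -> set 'rV[R]_n :=
  fun z => [set xi + gamma^-1 *: (z - w) | xi in F z].

Definition borel_rV : set (set 'rV[R]_n) := <<s open >>.

End Defs.

Section Prob.
Context {R : realType} {n : nat} {dT : measure_display} {T : measurableType dT}.

Definition sigma_of (X : T -> 'rV[R]_n) : set (set T) :=
  [set X @^-1` B | B in @borel_rV R n].

Definition sigma_upto (z : nat -> T -> 'rV[R]_n) (K : nat) : set (set T) :=
  <<s [set A | exists j B, (j <= K)%N /\ @borel_rV R n B /\ A = z j @^-1` B] >>.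

Definition rv_measurable (X : T -> 'rV[R]_n) : Prop :=
  forall B, @borel_rV R n B -> measurable (X @^-1` B).

(* "E[g | X] <= b  a.s.", stated through the defining property of the
   conditional expectation: for every A in sigma(X), E[g 1_A] <= b P(A). *)
Definition condexp_le (P : probability T R) (g : T -> R) (X : T -> 'rV[R]_n)
  (b : R) : Prop :=
  forall A, sigma_of X A -> (\int[P]_(w in A) (g w)%:E <= b%:E * P A)%E.

End Prob.

(* Main.v *)
(* With a_k = |z_k - z*|^2 for an MVI solution z*, the MVI inequality at z_{k+1}
   gives rho |z_{k+1} - z_k|^2 <= rho (a_k - a_{k+1}) + <xi_{k+1}, z_{k+1} - z*>,
   and strong monotonicity of the proximal operator gives
   rho |z_{k+1} - zbar(z_k)|^2 <= <xi_{k+1}, z_{k+1} - zbar(z_k)>.  Hence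
   E|z_k - zbar(z_k)|^2 <= 2 (E a_k - E a_{k+1}) + 4 c / (rho (k + 1)), which is
   summed against theta_k by Abel summation and
   sum_k theta_k >= K^(alpha + 1) / (alpha + 1).
   The conditional bound on xi_{k+1} holds only for deterministic test points,
   whereas zbar(z_k) is random.  So Z is cut into finitely many Borel cells of
   radius e with centres c_j, zbar(z_k) is replaced by zbar(c_j) on the event
   that z_k lies in the j-th cell, at the cost of an error O(e), and e tends
   to 0.  Restricted to cells, independence of tau is only needed for events. *)

Require Import Defs.
From HB Require Import structures.
From mathcomp Require Import all_boot all_order all_algebra.
From mathcomp Require Import all_classical all_reals all_analysis.
From mathcomp Require Import ring lra.
Import Order.TTheory GRing.Theory Num.Theory.
Import numFieldNormedType.Exports.
Local Open Scope classical_set_scope.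
Local Open Scope ring_scope.

(** * Euclidean inner product and norm on row vectors *)

Section Euclidean.
Context {R : realType} {n : nat}.
Implicit Types (u v w : 'rV[R]_n) (a : R).

Lemma dotvC u v : dotv u v = dotv v u.
Proof. by apply: eq_bigr => i _; rewrite mulrC. Qed.

Lemma dotvDl u v w : dotv (u + v) w = dotv u w + dotv v w.
Proof. by rewrite -big_split; apply: eq_bigr => i _; rewrite mxE mulrDl. Qed.

Lemma dotvZl a u v : dotv (a *: u) v = a * dotv u v.
Proof. by rewrite mulr_sumr; apply: eq_bigr => i _; rewrite mxE mulrA. Qed.

Lemma dotvNl u v : dotv (- u) v = - dotv u v.
Proof. by rewrite -scaleN1r dotvZl mulN1r. Qed.

Lemma dotvDr u v w : dotv w (u + v) = dotv w u + dotv w v.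
Proof. by rewrite dotvC dotvDl !(dotvC w). Qed.

Lemma dotvZr a u v : dotv v (a *: u) = a * dotv v u.
Proof. by rewrite dotvC dotvZl dotvC. Qed.

Lemma dotvNr u v : dotv v (- u) = - dotv v u.
Proof. by rewrite dotvC dotvNl dotvC. Qed.

Definition dotvE := (dotvDl, dotvDr, dotvNl, dotvNr, dotvZl, dotvZr).

Lemma dotv_ge0 u : 0 <= dotv u u.
Proof. by apply: sumr_ge0 => i _; rewrite -expr2 sqr_ge0. Qed.

Lemma sqr_enorm u : enorm u ^+ 2 = dotv u u.
Proof. by rewrite sqr_sqrtr ?dotv_ge0. Qed.

Lemma enorm_ge0 u : 0 <= enorm u.
Proof. exact: sqrtr_ge0. Qed.

Lemma enorm0 : enorm (0 : 'rV[R]_n) = 0.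
Proof. by rewrite /enorm -[X in dotv X _](scale0r 0) dotvZl mul0r sqrtr0. Qed.

Lemma enormB u v : enorm (u - v) = enorm (v - u).
Proof. by rewrite /enorm -opprB dotvNl dotvNr opprK. Qed.

(** Cauchy-Schwarz, from expanding [|s u - t v|^2 >= 0] at well-chosen [s] and [t]. *)
Lemma dotv_le_enorm u v : dotv u v <= enorm u * enorm v.
Proof.
have h s t : 0 <= s ^+ 2 * dotv u u - 2 * s * t * dotv u v + t ^+ 2 * dotv v v.
  have := dotv_ge0 (s *: u - t *: v).
  by rewrite !dotvE (dotvC v u); congr (_ <= _); ring.
have [u0|u0] := eqVneq (enorm u) 0.
  (* With [|u| = 0] these values turn [h] into [0 <= - (|v|^2 + 2) <u, v>^2], which forces
     [<u, v> = 0]. The case [|v| = 0] is symmetric. *)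
  have := h (dotv v v + 1) (dotv u v).
  have := sqr_enorm u; rewrite u0 mul0r expr0n /= => <-.
  have := dotv_ge0 v; nra.
have [v0|v0] := eqVneq (enorm v) 0.
  have := h (dotv u v) (dotv u u + 1).
  have := sqr_enorm v; rewrite v0 mulr0 expr0n /= => <-.
  have := dotv_ge0 u; nra.
have := h (enorm v) (enorm u); rewrite -!sqr_enorm.
have up : 0 < enorm u by rewrite lt_neqAle eq_sym u0 enorm_ge0.
have vp : 0 < enorm v by rewrite lt_neqAle eq_sym v0 enorm_ge0.
have uvp : 0 < enorm u * enorm v by rewrite mulr_gt0.
move=> hh; rewrite -(ler_pM2l uvp); nra.
Qed.

Lemma enormD u v : enorm (u + v) <= enorm u + enorm v.
Proof.
rewrite -(@ler_pXn2r _ 2) ?nnegrE ?addr_ge0 ?enorm_ge0 //.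
rewrite sqr_enorm sqrrD !sqr_enorm !dotvE (dotvC v u).
have := dotv_le_enorm u v; lra.
Qed.

Lemma enorm_triangle u v w : enorm (u - w) <= enorm (u - v) + enorm (v - w).
Proof. by have := enormD (u - v) (v - w); rewrite addrA subrK. Qed.

Lemma sqr_enormD_le u v :
  enorm (u + v) ^+ 2 <= 2 * enorm u ^+ 2 + 2 * enorm v ^+ 2.
Proof.
rewrite !sqr_enorm !dotvE (dotvC v u).
have := dotv_ge0 (u - v); rewrite !dotvE (dotvC v u); lra.
Qed.

End Euclidean.

(** * Sums of the weights [(k + 1)^a] *)

Section Powers.
Context {R : realType}.
Implicit Types (a : R) (m K : nat).

(* Young's inequality for (x - 1) * x^a with exponents a + 1 and (a + 1) / a. *)
Lemma powR_succ_le a m : 1 <= a ->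
  m.+1%:R `^ (a + 1) <= m%:R `^ (a + 1) + (a + 1) * m.+1%:R `^ a :> R.
Proof.
move=> a1; have a0 : 0 < a by lra.
have b0 : 0 < a + 1 by lra.
have := @conjugate_powR R m%:R (m.+1%:R `^ a) (a + 1) ((a + 1) / a).
rewrite ler0n powR_ge0 b0 divr_gt0 // => /(_ isT isT isT isT).
have -> : (a + 1)^-1 + ((a + 1) / a)^-1 = 1 by field; lra.
move=> /(_ erefl).
rewrite -powRrM (_ : a * ((a + 1) / a) = a + 1); last by field; lra.
move=> h.
have e : m.+1%:R `^ (a + 1) = m.+1%:R * m.+1%:R `^ a :> R.
  by rewrite powRD ?powRr1 ?pnatr_eq0 ?implybT // mulrC.
have : (a + 1) * (m%:R * m.+1%:R `^ a) <=
   m%:R `^ (a + 1) + a * m.+1%:R `^ (a + 1).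
  have := ler_wpM2l (ltW b0) h.
  suff -> : forall x y : R,
      (a + 1) * (x / (a + 1) + y / ((a + 1) / a)) = x + a * y by [].
  by move=> x y; field; lra.
rewrite e -[m.+1]addn1 natrD; set X := (_ `^ a); lra.
Qed.

(** Discrete form of comparing the sum with the integral of [x^a]: [powR_succ_le] bounds each
    increment of [m^(a + 1)], and the increments telescope. *)
Lemma sum_powR_ge a K : 1 <= a ->
  K%:R `^ (a + 1) <= (a + 1) * \sum_(k < K) k.+1%:R `^ a.
Proof.
move=> a1; elim: K => [|K IH].
  by rewrite big_ord0 mulr0 powR0 // gt_eqF //; lra.
rewrite big_ord_recr /= mulrDr; apply: le_trans (powR_succ_le a K a1) _.
by rewrite lerD2r.
Qed.

(** Controls the weighted errors [c / (k + 1)]. The new term is [(K + 1)^(a - 1)], and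
    [K^a <= K (K + 1)^(a - 1)] because [a >= 1]; the two add up to [(K + 1)^a]. *)
Lemma sum_powR_div_le a K : 1 <= a ->
  \sum_(k < K) k.+1%:R `^ a / k.+1%:R <= K%:R `^ a.
Proof.
move=> a1; elim: K => [|K IH].
  by rewrite big_ord0 powR_ge0.
rewrite big_ord_recr /=; apply: le_trans (lerD IH (lexx _)) _.
have e m : m.+1%:R `^ a = m.+1%:R * m.+1%:R `^ (a - 1) :> R.
  rewrite -{2}[m.+1%:R]powRr1 ?ler0n // -powRD ?pnatr_eq0 ?implybT //.
  by congr (_ `^ _); ring.
have : K%:R `^ a <= K%:R * K.+1%:R `^ (a - 1) :> R.
  case: K {IH} => [|K]; first by rewrite powR0 ?mul0r // gt_eqF //; lra.
  rewrite e ler_wpM2l ?ler0n // ge0_ler_powR ?nnegrE ?ler0n ?ler_nat //; lra.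
rewrite e mulrAC mulfV ?pnatr_eq0 // mul1r -[K.+1]addn1 natrD.
by set X := (_ `^ (a - 1)); lra.
Qed.

(** Abel summation: the weights increase and [M - s m] is nonnegative, so raising the weight of this
    remainder from [m^a] to [(m + 1)^a] only enlarges the bound. *)
Lemma sum_powR_telescope_le a (s : nat -> R) (M : R) K : 1 <= a ->
  (forall k, (k <= K)%N -> 0 <= s k <= M) ->
  \sum_(k < K) k.+1%:R `^ a * (s k - s k.+1) <= K%:R `^ a * M.
Proof.
move=> a1 sM.
(* The induction needs the sharper bound that keeps [- s m]; it is dropped at [m = K], where
   [s K >= 0]. *)
suff h m : (m <= K)%N ->
    \sum_(k < m) k.+1%:R `^ a * (s k - s k.+1) <= m%:R `^ a * (M - s m).
  apply: le_trans (h _ (leqnn _)) _; apply: ler_wpM2l; first exact: powR_ge0.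
  by have := sM _ (leqnn K); lra.
elim: m => [|m IH] mK.
  by rewrite big_ord0 mulr_ge0 ?powR_ge0 //; have := sM _ mK; lra.
rewrite big_ord_recr /=; apply: le_trans (lerD (IH (ltnW mK)) (lexx _)) _.
have : m%:R `^ a <= m.+1%:R `^ a :> R.
  by rewrite ge0_ler_powR ?nnegrE ?ler0n ?ler_nat //; lra.
have := sM _ (ltnW mK).
set X := _ `^ a; set Y := _ `^ a => /andP[_ s1] XY.
have := ler_wpM2r (_ : 0 <= M - s m) XY; rewrite subr_ge0 => /(_ s1); lra.
Qed.

End Powers.

Lemma sqr_le_near {R : realFieldType} (x y D d : R) :
  0 <= x <= D -> 0 <= y <= D -> 0 <= d -> x <= y + d ->
  x ^+ 2 <= y ^+ 2 + 2 * D * d.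
Proof.
move=> /andP[x0 xD] /andP[y0 yD] d0 xy.
have h1 : (x - y) * (x + y) <= d * (x + y) by apply: ler_wpM2r; lra.
have h2 : d * (x + y) <= d * (2 * D) by apply: ler_wpM2l => //; lra.
by move: h1 h2; rewrite !expr2; lra.
Qed.

(** * Deterministic estimates for the proximal operator *)

Section Proximal.
Context {R : realType} {n : nat}.
Variables (Z : set 'rV[R]_n) (F : 'rV[R]_n -> set 'rV[R]_n) (rho : R).
Hypotheses (rho0 : 0 < rho) (Fmon : weakly_monotone F Z rho).
Local Notation prox := (prox_op F (2 * rho)^-1).
Implicit Types (p q u w zs : 'rV[R]_n) (D e : R).

(* [u + 2 rho (w' - w)] is the element of the operator centred at [w] that
   corresponds to [u], and that operator is rho-strongly monotone. *)
Lemma prox_SVI_dist w w' p q u : Z p -> prox w' p u ->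
  is_SVI_sol (prox w) Z q ->
  rho * enorm (p - q) ^+ 2 <= dotv (u + (2 * rho) *: (w' - w)) (p - q).
Proof.
move=> Zp [f Fp <-] [Zq [_ [g Fq <-] /(_ p Zp)]].
have := Fmon p q f g Zp Zq Fp Fq.
rewrite !invrK sqr_enorm !dotvE.
set x := dotv _ _; lra.
Qed.

(** Testing the inequality solved by [p] at [q] gives [<u, p - q> <= 0], so [prox_SVI_dist] leaves
    only the shift [2 rho (w' - w)]. Cauchy-Schwarz and division by [rho |p - q|] yield the factor
    2. *)
Lemma prox_SVI_lipschitz w w' p q : is_SVI_sol (prox w') Z p ->
  is_SVI_sol (prox w) Z q -> enorm (p - q) <= 2 * enorm (w' - w).
Proof.
move=> [Zp [u Fp up]] qsol.
have [Zq _] := qsol.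
have := prox_SVI_dist w w' p q u Zp Fp qsol.
have := up q Zq; rewrite -opprB dotvNr dotvDl dotvZl.
have := dotv_le_enorm (w' - w) (p - q).
have := enorm_ge0 (p - q); rewrite le_eqVlt => /predU1P[<- *|pq0].
  by rewrite mulr_ge0 ?enorm_ge0.
move=> cs up' h; rewrite -(ler_pM2r pq0) -(ler_pM2l rho0).
have := ler_wpM2l (ltW rho0) cs; rewrite -!mulrA -expr2.
move: up' h; set a := dotv _ _; set b := dotv _ _.
by set c := _ * enorm _; nra.
Qed.

(** The MVI inequality is applied to [u - 2 rho (p - w)], an element of [F p]; then
    [2 <p - w, p - zs>] is expanded as [|p - w|^2 + |p - zs|^2 - |w - zs|^2]. *)
Lemma prox_MVI_descent w p u zs : Z p -> prox w p u -> is_MVI_sol F Z zs ->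
  rho * enorm (p - w) ^+ 2 <=
  rho * (enorm (w - zs) ^+ 2 - enorm (p - zs) ^+ 2) + dotv u (p - zs).
Proof.
move=> Zp [f Fp <-] [_ /(_ p f Zp Fp)].
rewrite !invrK !sqr_enorm !dotvE (dotvC w p) (dotvC zs p) (dotvC zs w).
lra.
Qed.

Variables (D : R) (zbar : 'rV[R]_n -> 'rV[R]_n).
Hypothesis (ZD : diam_le Z D).
Hypothesis (zbarP : forall w, Z w -> is_SVI_sol (prox w) Z (zbar w)).

(** Moving the point costs [e] and moving its proximal solution costs [2 e], so the residual changes
    by at most [3 e]; squaring multiplies this by [2 D]. *)
Lemma residual_near w w' e : Z w -> Z w' -> enorm (w' - w) <= e ->
  enorm (w' - zbar w') ^+ 2 <= enorm (w - zbar w) ^+ 2 + 6 * D * e.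
Proof.
move=> Zw Zw' we.
have Lip := prox_SVI_lipschitz w' w _ _ (zbarP w Zw) (zbarP w' Zw').
rewrite (enormB w) in Lip.
have [Zbw _] := zbarP w Zw; have [Zbw' _] := zbarP w' Zw'.
have h1 := enorm_triangle w' w (zbar w').
have h2 := enorm_triangle w (zbar w) (zbar w').
have d1 := ZD _ _ Zw Zbw; have d2 := ZD _ _ Zw' Zbw'.
have g1 := enorm_ge0 (w - zbar w); have g2 := enorm_ge0 (w' - zbar w').
have g3 := enorm_ge0 (w' - w).
rewrite (_ : 6 * D * e = 2 * D * (3 * e)); last by ring.
apply: sqr_le_near; rewrite ?g1 ?g2 ?g3 ?d1 ?d2 ?d3 //; lra.
Qed.

(** Here [w] stands for a cell centre, [w'] for the current iterate and [p] for the next one. Of the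
    error [6 D e], a part [2 D e] comes from exchanging [w] for [w'] in the residual, and [4 D e]
    from the shift term in [prox_SVI_dist]. *)
Lemma residual_le w w' p u zs e : Z w -> Z w' -> Z p ->
  enorm (w' - w) <= e -> prox w' p u -> is_MVI_sol F Z zs ->
  enorm (w - zbar w) ^+ 2 <=
  2 * (enorm (w' - zs) ^+ 2 - enorm (p - zs) ^+ 2) +
  2 / rho * (dotv u (p - zs) + dotv u (p - zbar w)) + 6 * D * e.
Proof.
move=> Zw Zw' Zp we up zsP; have [Zbw _] := zbarP w Zw.
have h1 := prox_SVI_dist w w' p (zbar w) u Zp up (zbarP w Zw).
have h2 := prox_MVI_descent w' p u zs Zp up zsP.
rewrite dotvDl dotvZl in h1.
have cs := dotv_le_enorm (w' - w) (p - zbar w).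
have d1 := ZD _ _ Zp Zbw; have d2 := ZD _ _ Zw Zbw; have d3 := ZD _ _ Zw' Zbw.
have g0 := enorm_ge0 (w' - w); have g1 := enorm_ge0 (p - zbar w).
have g2 := enorm_ge0 (w - zbar w); have g3 := enorm_ge0 (w' - zbar w).
have cs' : dotv (w' - w) (p - zbar w) <= e * D.
  by apply: le_trans cs _; apply: ler_pM.
have t := enorm_triangle w w' (zbar w); rewrite (enormB w w') in t.
have s1 : enorm (w - zbar w) ^+ 2 <= enorm (w' - zbar w) ^+ 2 + 2 * D * e.
  by apply: sqr_le_near; rewrite ?g1 ?g2 ?g3 ?d1 ?d2 ?d3 //; lra.
have s2 := sqr_enormD_le (w' - p) (p - zbar w).
rewrite addrA subrK (enormB w' p) in s2.
rewrite -(ler_pM2l rho0).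
have -> (A B C : R) :
    rho * (2 * A + 2 / rho * B + C) = 2 * rho * A + 2 * B + rho * C.
  by field; rewrite gt_eqF.
have s3 := ler_wpM2l (ltW rho0) (le_trans s1 (lerD s2 (lexx _))).
have s4 := ler_wpM2l (ltW rho0) cs'.
move: h1 h2 s3 s4; lra.
Qed.

End Proximal.

(** * Finite Borel partitions of a compact set into small cells *)

Section BorelNet.
Context {R : realType} {n : nat}.
Implicit Types (s : seq 'rV[R]_n) (e : R).

Lemma enorm_sub_continuous (w : 'rV[R]_n) :
  continuous (fun z : 'rV[R]_n => enorm (z - w)).
Proof.
have h i : continuous (fun z : 'rV[R]_n => (z - w) ord0 i : R).
  rewrite (_ : (fun z : 'rV[R]_n => _) = (fun z => z ord0 i - w ord0 i)).
    move=> z; exact: (cvgB (@coord_continuous R 1 n ord0 i z) (cvg_cst _)).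
  by apply/funext => z; rewrite !mxE.
have hs : continuous (fun z : 'rV[R]_n => dotv (z - w) (z - w) : R).
  have add_cont : continuous (fun x : R * R => x.1 + x.2).
    by move=> x; apply: cvgD; [exact: cvg_fst|exact: cvg_snd].
  apply: (continuous_big add_cont) => i _ z.
  exact: (cvgM (h i z) (h i z)).
move=> z; exact: (continuous_comp (hs z) (@sqrt_continuous R _)).
Qed.

(** [find] returns the first ball of the list containing [z], so its fibers are Boolean combinations
    of open balls. *)
Lemma borel_find s e (i : nat) :
  borel_rV [set z | find (fun w => enorm (z - w) < e) s = i].
Proof.
have [S0 SC SU] := smallest_sigma_algebra [set: 'rV[R]_n] open.
have SI A B : borel_rV A -> borel_rV B -> @borel_rV R n (A `&` B).
  move=> mA mB; rewrite -[A `&` B]setCK setCI -!setTD; apply: (SC).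
  rewrite -bigcup2E; apply: (SU) => -[|[|k]] /=; [exact: SC|exact: SC|exact: S0].
have SO w : borel_rV [set z : 'rV[R]_n | enorm (z - w) < e].
  apply: sub_sigma_algebra.
  have /continuousP := enorm_sub_continuous w.
  by move=> /(_ _ (@open_lt R e)).
elim: s i => [|w s IH] [|i] /=.
- rewrite (_ : [set _ | _] = setT); last by apply/seteqP; split.
  by rewrite -(setD0 setT); apply: (SC).
- by rewrite (_ : [set _ | _] = set0); last by apply/seteqP; split.
- rewrite (_ : [set _ | _] = [set z | enorm (z - w) < e]) //.
  by apply/seteqP; split => z /=; case: ifP.
rewrite (_ : [set _ | _] = (setT `\` [set z | enorm (z - w) < e]) `&`
    [set z | find (fun w => enorm (z - w) < e) s = i]).
  exact: (SI _ _ (SC _ (SO w)) (IH i)).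
by apply/seteqP; split => z /=; case: ifP => // _;
  [case=> <-|case=> -[]|case=> _ ->].
Qed.

Lemma compact_borel_net (Z : set 'rV[R]_n) z0 e : compact Z -> Z z0 -> 0 < e ->
  exists (J : finType) (phi : 'rV[R]_n -> J) (c : J -> 'rV[R]_n),
    [/\ forall j, borel_rV (phi @^-1` [set j]), forall j, Z (c j) &
        forall z, Z z -> enorm (z - c (phi z)) <= e].
Proof.
move=> cZ Zz0 e0; move: cZ; rewrite compact_cover.
move=> /(_ 'rV[R]_n Z (fun w => [set z | enorm (z - w) < e])) [].
- move=> w _; have /continuousP := enorm_sub_continuous w.
  by move=> /(_ _ (@open_lt R e)).
- by move=> z Zz; exists z => //=; rewrite subrr enorm0.
move=> D' D'Z D'cov; set s : seq _ := finmap.enum_fset D'.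
pose a (z : 'rV[R]_n) := fun w : 'rV[R]_n => enorm (z - w) < e.
(* The extra index [size s] collects the points outside every ball; its centre is the default [z0],
   which keeps all centres in [Z]. *)
pose phi (z : 'rV[R]_n) : 'I_(size s).+1 := Ordinal (find_size (a z) s : (_ < (size s).+1)%N).
exists 'I_(size s).+1, phi, (fun j : 'I_(size s).+1 => nth z0 s j); split.
- move=> j; rewrite (_ : _ @^-1` _ = [set z | find (a z) s = j]).
    exact: borel_find.
  by apply/seteqP; split => z /=; [move=> <-|move=> h; exact: val_inj].
- move=> j; have [js|js] := ltnP j (size s); last by rewrite nth_default.
  by apply/set_mem/D'Z/mem_nth.
- move=> z /D'cov[w /= wD' zw]; apply/ltW/(nth_find z0 (a := a z)).
  by apply/hasP; exists w.
Qed.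

End BorelNet.

(** * Integration along a finite measurable partition *)

Section FiniteFibers.
Context {R : realType} {dT : measure_display} {T : measurableType dT}.
Variable P : probability T R.
Context {J : finType} (psi : T -> J).
Hypothesis mpsi : forall j, measurable (psi @^-1` [set j]).

Lemma integrable_prob_bounded (f : T -> R) (M : R) : measurable_fun setT f ->
  (forall t, `|f t| <= M) -> P.-integrable setT (EFin \o f).
Proof.
move=> mf fM; apply: measurable_bounded_integrable => //.
  exact: (le_lt_trans (probability_le1 P measurableT) (ltry _)).
exists M; split; first exact: num_real.
by move=> x Mx t _; exact: le_trans (fM t) (ltW Mx).
Qed.

Lemma Rintegral_fibers (f : T -> R) : P.-integrable setT (EFin \o f) ->
  \int[P]_t f t = \sum_j \int[P]_(t in psi @^-1` [set j]) f t.
Proof.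
move=> fi; have := fi => /integrableP[mf _].
have cover : \big[setU/set0]_(j <- index_enum J) (psi @^-1` [set j]) = setT.
  apply/seteqP; split => // t _; rewrite -bigcup_seq.
  by exists (psi t) => //=; rewrite mem_index_enum.
rewrite /Rintegral -cover integral_bigsetU_EFin ?index_enum_uniq //.
- rewrite -sum_fine // => j _; apply: integrable_fin_num => //.
  exact: integrableS fi.
- by move=> i j _ _ [t [/= <- <-]].
- by rewrite cover.
Qed.

Lemma Rintegral_fiber_cst (r : R) j :
  \int[P]_(t in psi @^-1` [set j]) r = r * fine (P (psi @^-1` [set j])).
Proof. by rewrite Rintegral_cst. Qed.

Lemma sum_prob_fibers : \sum_j fine (P (psi @^-1` [set j])) = 1.
Proof.
have one : \int[P]_(t in setT) (1 : R) = 1.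
  by rewrite Rintegral_cst // mul1r; have := congr1 fine (probability_setT P).
rewrite -[RHS]one Rintegral_fibers; last first.
  by apply: (@integrable_prob_bounded _ 1) => // t; rewrite normr1.
by apply: eq_bigr => j _; rewrite Rintegral_fiber_cst mul1r.
Qed.

Lemma measurable_fun_fibers (H : J -> R) : measurable_fun setT (H \o psi).
Proof.
move=> _ Y _; rewrite setTI.
rewrite (_ : _ @^-1` _ = \bigcup_(j in [set j | Y (H j)]) (psi @^-1` [set j])).
  by apply: fin_bigcup_measurable => // ; exact: finite_finset.
by apply/seteqP; split => [t Yt|t [j Yj /= ->]] //=; exists (psi t).
Qed.

(** Serves for the residual at the random index: it is dominated by a function of finitely many
    values, whose integral is a finite sum over fibers. *)
Lemma expectation_le_fibers (f : T -> R) (H : J -> R) :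
  (forall t, 0 <= f t <= H (psi t)) ->
  ('E_P[f] <= (\sum_j H j * fine (P (psi @^-1` [set j])))%:E)%E.
Proof.
move=> fH; rewrite unlock.
have Hi : P.-integrable setT (EFin \o (H \o psi)).
  apply: (@integrable_prob_bounded _ (\sum_j `|H j|)) => [|t].
    exact: measurable_fun_fibers.
  by rewrite /= (bigD1 (psi t)) //= lerDl sumr_ge0.
have -> : (\sum_j H j * fine (P (psi @^-1` [set j])))%:E =
          (\int[P]_t (H (psi t))%:E)%E.
  rewrite -[RHS]fineK; last exact: integrable_fin_num Hi.
  congr EFin; rewrite -[RHS]/(Rintegral P setT (H \o psi)) Rintegral_fibers //.
  apply: eq_bigr => j _; rewrite -Rintegral_fiber_cst.
  by apply: eq_Rintegral => t; rewrite inE => /= ->.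
rewrite !ge0_integralTE => [|t|t]; rewrite ?lee_fin; last 2 first.
- by case/andP: (fH t) => h1 h2; exact: le_trans h1 h2.
- by case/andP: (fH t).
(* The integral of a nonnegative function is a supremum over the simple functions
   below it, hence monotone even though [f] may fail to be measurable. *)
apply: ereal_sup_le => _ [h hf <-]; exists h => // t.
by apply: le_trans (hf t) _; rewrite lee_fin; case/andP: (fH t).
Qed.

End FiniteFibers.

(** * Expected residual of one proximal step *)

Section Step.
Context {R : realType} {n : nat} {dT : measure_display} {T : measurableType dT}.
Variable P : probability T R.

Lemma rv_measurable_fun (X : T -> 'rV[R]_n) (f : 'rV[R]_n -> R) :
  rv_measurable X -> continuous f -> measurable_fun setT (f \o X).
Proof.
move=> mX /continuousP cf.
apply: (measurability _ (measurable_realfun.RGenOpens.measurableE R)).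
move=> _ [B [x [y ->]] <-]; rewrite setTI comp_preimage.
by apply: mX; apply: sub_sigma_algebra; apply: cf; exact: interval_open.
Qed.

Variables (Z : set 'rV[R]_n) (F : 'rV[R]_n -> set 'rV[R]_n) (rho D : R).
Variables (zbar : 'rV[R]_n -> 'rV[R]_n) (zs : 'rV[R]_n).
Local Notation prox := (prox_op F (2 * rho)^-1).
Hypotheses (rho0 : 0 < rho) (Fmon : weakly_monotone F Z rho).
Hypotheses (ZD : diam_le Z D) (zsP : is_MVI_sol F Z zs).
Hypothesis (zbarP : forall w, Z w -> is_SVI_sol (prox w) Z (zbar w)).

Lemma sqr_enorm_le_diam p q : Z p -> Z q -> enorm (p - q) ^+ 2 <= D ^+ 2.
Proof.
move=> Zp Zq; have d0 := le_trans (enorm_ge0 _) (ZD p q Zp Zq).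
by rewrite ler_pXn2r ?nnegrE ?enorm_ge0 // ZD.
Qed.

Lemma integrable_sqr_dist (X : T -> 'rV[R]_n) :
  rv_measurable X -> (forall t, Z (X t)) ->
  P.-integrable setT (EFin \o (fun t => enorm (X t - zs) ^+ 2)).
Proof.
move=> mX ZX; apply: (integrable_prob_bounded P _ (D ^+ 2)) => [|t].
  apply: measurable_realfun.measurable_funX.
  exact: (rv_measurable_fun X _ mX (enorm_sub_continuous zs)).
by rewrite ger0_norm ?sqr_ge0 // sqr_enorm_le_diam //; case: zsP.
Qed.

Lemma mean_sqr_dist_itv (X : T -> 'rV[R]_n) :
  rv_measurable X -> (forall t, Z (X t)) ->
  0 <= \int[P]_t (enorm (X t - zs) ^+ 2) <= D ^+ 2.
Proof.
move=> mX ZX; have Xi := integrable_sqr_dist X mX ZX.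
have cst (r : R) : \int[P]_(t in setT) r = r.
  rewrite Rintegral_cst // -[RHS]mulr1; congr (_ * _).
  by have := congr1 fine (probability_setT P).
have ci (r : R) : P.-integrable setT (EFin \o (fun=> r)).
  exact: (integrable_prob_bounded P _ `|r|).
apply/andP; split; [rewrite -(cst 0)|rewrite -(cst (D ^+ 2))].
  by apply: le_Rintegral => // t _; exact: sqr_ge0.
by apply: le_Rintegral => // t _; apply: sqr_enorm_le_diam => //; case: zsP.
Qed.

Variables (X Y xi : T -> 'rV[R]_n) (b e : R).
Hypotheses (mX : rv_measurable X) (ZX : forall t, Z (X t)).
Hypotheses (mY : rv_measurable Y) (ZY : forall t, Z (Y t)).
Hypothesis (xiP : forall t, prox (X t) (Y t) (xi t)).
Hypothesis (xi_int : forall y, Z y ->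
  P.-integrable setT (fun t => (dotv (xi t) (Y t - y))%:E)).
Hypothesis (xi_le : forall y, Z y ->
  condexp_le P (fun t => dotv (xi t) (Y t - y)) X b).

Context {J : finType} (phi : 'rV[R]_n -> J) (c : J -> 'rV[R]_n).
Hypotheses (mphi : forall j, borel_rV (phi @^-1` [set j])).
Hypotheses (Zc : forall j, Z (c j)).
Hypothesis (phic : forall w, Z w -> enorm (w - c (phi w)) <= e).

Lemma expected_residual_step :
  \sum_j enorm (c j - zbar (c j)) ^+ 2 * fine (P (X @^-1` (phi @^-1` [set j])))
  <= 2 * (\int[P]_t (enorm (X t - zs) ^+ 2) - \int[P]_t (enorm (Y t - zs) ^+ 2))
     + 4 * b / rho + 6 * D * e.
Proof.
have [Zzs _] := zsP.
have mA j : measurable ((phi \o X) @^-1` [set j]) by exact: (mX _ (mphi j)).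
pose A j := X @^-1` (phi @^-1` [set j]).
have Xi := integrable_sqr_dist X mX ZX.
have Yi := integrable_sqr_dist Y mY ZY.
(* The cell event [A j] belongs to the sigma-algebra of [X], so the conditional bound can be
   integrated over it for each fixed [y]. *)
have xi_fine y j : Z y ->
    \int[P]_(t in A j) dotv (xi t) (Y t - y) <= b * fine (P (A j)).
  move=> Zy; have PA : P (A j) \is a fin_num by apply: fin_num_measure; exact: mA.
  rewrite -lee_fin EFinM (fineK PA) /Rintegral fineK; last first.
    apply: integrable_fin_num; first exact: mA.
    by apply: integrableS (xi_int y Zy) => //; exact: mA.
  by apply: xi_le => //; exists (phi @^-1` [set j]).
have cell j : enorm (c j - zbar (c j)) ^+ 2 * fine (P (A j)) <=
    2 * (\int[P]_(t in A j) (enorm (X t - zs) ^+ 2)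
         - \int[P]_(t in A j) (enorm (Y t - zs) ^+ 2))
    + (4 * b / rho + 6 * D * e) * fine (P (A j)).
  have [Zb _] := zbarP (c j) (Zc j).
  have sub f : P.-integrable setT f -> P.-integrable (A j) f.
    by move=> fi; apply: integrableS fi => //; exact: mA.
  have Xj := sub _ Xi; have Yj := sub _ Yi.
  have G1 := sub _ (xi_int zs Zzs); have G2 := sub _ (xi_int _ Zb).
  (* The right-hand side of [residual_le] at the centre [c j]. Its test points [zs] and [zbar (c j)]
     are both deterministic, as [xi_fine] demands. *)
  pose g t := 2 * (enorm (X t - zs) ^+ 2 - enorm (Y t - zs) ^+ 2) +
    2 / rho * (dotv (xi t) (Y t - zs) + dotv (xi t) (Y t - zbar (c j))) +
    6 * D * e.
  have XYj : P.-integrable (A j)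
      (EFin \o (fun t => enorm (X t - zs) ^+ 2 - enorm (Y t - zs) ^+ 2)).
    exact: (integrableB (mA j) Xj Yj).
  have G12 : P.-integrable (A j)
      (EFin \o (fun t => dotv (xi t) (Y t - zs) + dotv (xi t) (Y t - zbar (c j)))).
    exact: (integrableD (mA j) G1 G2).
  have XYj2 : P.-integrable (A j)
      (EFin \o (fun t => 2 * (enorm (X t - zs) ^+ 2 - enorm (Y t - zs) ^+ 2))).
    exact: (integrableZl (mA j) 2 XYj).
  have G122 : P.-integrable (A j) (EFin \o (fun t => 2 / rho *
      (dotv (xi t) (Y t - zs) + dotv (xi t) (Y t - zbar (c j))))).
    exact: (integrableZl (mA j) (2 / rho) G12).
  have S : P.-integrable (A j) (EFin \o (fun t =>
      2 * (enorm (X t - zs) ^+ 2 - enorm (Y t - zs) ^+ 2) + 2 / rho *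
      (dotv (xi t) (Y t - zs) + dotv (xi t) (Y t - zbar (c j))))).
    exact: (integrableD (mA j) XYj2 G122).
  have C (r : R) : P.-integrable (A j) (EFin \o (fun _ => r)).
    by apply: sub; apply: (integrable_prob_bounded P _ `|r|).
  have gi : P.-integrable (A j) (EFin \o g).
    exact: (integrableD (mA j) S (C _)).
  have hg t : A j t -> enorm (c j - zbar (c j)) ^+ 2 <= g t.
    move=> At; have Pt : phi (X t) = j := At.
    apply: (residual_le Z F rho rho0 Fmon D zbar ZD zbarP) => //.
    by rewrite -[in c j]Pt; exact: phic.
  have := le_Rintegral (mA j) (C (enorm (c j - zbar (c j)) ^+ 2)) gi hg.
  rewrite (Rintegral_fiber_cst P (phi \o X) mA) => /le_trans; apply.
  rewrite (RintegralD (mA j) S (C _)) (RintegralD (mA j) XYj2 G122).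
  rewrite (RintegralZl 2 (mA j) XYj) (RintegralB (mA j) Xj Yj).
  rewrite (RintegralZl (2 / rho) (mA j) G12) (RintegralD (mA j) G1 G2).
  rewrite (Rintegral_fiber_cst P (phi \o X) mA).
  have h1 := xi_fine zs j Zzs; have h2 := xi_fine _ j Zb.
  have r2 : 0 <= 2 / rho by rewrite divr_ge0 // ltW.
  have h3 := ler_wpM2l r2 (lerD h1 h2).
  (* Each of the two test points contributes one [b]. *)
  rewrite (_ : 4 * b / rho = 2 / rho * (b + b)); last by field; rewrite gt_eqF.
  by move: h3; rewrite -/(A j) /comp /=; set p := fine _; lra.
apply: le_trans (ler_sum _ (fun j _ => cell j)) _.
rewrite big_split /= -!mulr_sumr sumrB (sum_prob_fibers P (phi \o X) mA) mulr1.
have fib := Rintegral_fibers P (phi \o X) mA.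
by rewrite -(fib _ Xi) -(fib _ Yi) addrA.
Qed.

End Step.

(** * Averaging over the random index and letting the cell radius vanish *)

Theorem theorem7 (R : realType) (n : nat)
  (Z : set 'rV[R]_n) (D rho : R) (F : 'rV[R]_n -> set 'rV[R]_n)
  (alpha c : R) (K : nat)
  (dT : measure_display) (T : measurableType dT) (P : probability T R)
  (z0 : 'rV[R]_n) (z xi : nat -> T -> 'rV[R]_n) (tau : T -> nat)
  (zbar : 'rV[R]_n -> 'rV[R]_n) :
  convex_set Z -> compact Z -> diam_le Z D ->
  0 < rho -> weakly_monotone F Z rho ->
  (exists zs, is_MVI_sol F Z zs) ->
  let gamma := (2 * rho)^-1 in
  let theta := fun k : nat => (k.+1%:R : R) `^ alpha in
  1 <= alpha -> (1 <= K)%N -> 0 < c ->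
  Z z0 -> z 0%N = (fun _ => z0) ->
  (forall k, (k <= K)%N -> rv_measurable (z k) /\ forall w, Z (z k w)) ->
  (forall k, (k < K)%N ->
     (forall w, prox_op F gamma (z k w) (z k.+1 w) (xi k.+1 w)) /\
     (forall y, Z y ->
        P.-integrable setT (fun w => (dotv (xi k.+1 w) (z k.+1 w - y))%:E) /\
        condexp_le P (fun w => dotv (xi k.+1 w) (z k.+1 w - y)) (z k)
          (c / k.+1%:R))) ->
  (forall w, (tau w < K)%N) ->
  (forall k, (k < K)%N -> measurable [set w | tau w = k] /\
     P [set w | tau w = k] = (theta k / \sum_(l < K) theta l)%:E) ->
  (forall k A, sigma_upto z K A ->
     P ([set w | tau w = k] `&` A) = (P [set w | tau w = k] * P A)%E) ->
  (forall w, Z w -> is_SVI_sol (prox_op F gamma w) Z (zbar w)) ->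
  ('E_P[(fun w => enorm (z (tau w) w - zbar (z (tau w) w)) ^+ 2)%R]
     <= (2 * D ^+ 2 * (alpha + 1) / K%:R + 4 * c * (alpha + 1) / (K%:R * rho))%:E)%E.
Proof.
move=> _ cZ ZD rho0 Fmon [zs zsP] gamma theta a1 K1 c0 Zz0 _ zP xiP tauK tauP tauI zbarP.
have D0 : 0 <= D by have := ZD _ _ Zz0 Zz0; rewrite subrr enorm0.
set S := \sum_(l < K) theta l in tauP.
have Kpos : 0 < K%:R :> R by rewrite ltr0n.
have KS : K%:R `^ (alpha + 1) <= (alpha + 1) * S := sum_powR_ge alpha K a1.
have a10 : 0 < alpha + 1 by lra.
have S0 : 0 < S.
  have := lt_le_trans (powR_gt0 (alpha + 1) Kpos) KS.
  by rewrite pmulr_rgt0.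
apply/lee_addgt0Pr => d d0.
(* The total cell error will be [12 D e], half from [residual_near] and half from
   [expected_residual_step]. The [+ 1] keeps the denominator positive when [D = 0]. *)
pose e := d / (12 * D + 1).
have D1 : 0 < 12 * D + 1 by lra.
have e0 : 0 < e by rewrite divr_gt0.
have De : 12 * D * e <= d.
  by rewrite /e mulrA ler_pdivrMr // mulrDr mulr1 mulrC lerDl ltW.
have [J [phi [cc [mphi Zc phic]]]] := compact_borel_net Z z0 e cZ Zz0 e0.
(* Records the index together with the cell of the selected iterate. Independence of [tau] then
   factors the probability of each fiber into [theta k / S] times that of [A k j]. *)
pose psi t : 'I_K * J := (Ordinal (tauK t), phi (z (tau t) t)).
pose A k j := z k @^-1` (phi @^-1` [set j]).
pose h j := enorm (cc j - zbar (cc j)) ^+ 2.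
have fiberE kj : psi @^-1` [set kj] = [set t | tau t = kj.1] `&` A kj.1 kj.2.
  case: kj => k j; apply/seteqP; split => t /=; first by case=> <- <-.
  by move=> [tk Atj]; congr pair; [exact: val_inj|rewrite tk].
have mA (k : 'I_K) j : measurable (A k j) by exact: (zP k (ltnW (ltn_ord k))).1.
have mpsi kj : measurable (psi @^-1` [set kj]).
  by rewrite fiberE; apply: measurableI => //; exact: (tauP _ (ltn_ord _)).1.
have Ppsi kj : fine (P (psi @^-1` [set kj])) =
    theta kj.1 / S * fine (P (A kj.1 kj.2)).
  rewrite fiberE tauI; last first.
    apply: sub_sigma_algebra; exists (kj.1 : nat), (phi @^-1` [set kj.2]).
    by rewrite ltnW.
  by rewrite fineM ?(tauP _ (ltn_ord _)).2 // fin_num_measure.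
have psi_le t : 0 <= enorm (z (tau t) t - zbar (z (tau t) t)) ^+ 2 <=
    h (psi t).2 + 6 * D * e.
  rewrite sqr_ge0 /=; have [_ Zz] := zP _ (ltnW (tauK t)).
  apply: (residual_near Z F rho rho0 Fmon D zbar ZD zbarP) => //.
  exact: phic.
pose H (kj : 'I_K * J) := h kj.2 + 6 * D * e.
apply: le_trans (expectation_le_fibers P psi mpsi _ H psi_le) _.
rewrite -EFinD lee_fin.
under eq_bigr do rewrite Ppsi.
rewrite -(pair_bigA _ (fun (k : 'I_K) (j : J) =>
  (h j + 6 * D * e) * (theta k / S * fine (P (A k j))))) /=.
pose E k := \int[P]_t (enorm (z k t - zs) ^+ 2).
have E_itv k : (k <= K)%N -> 0 <= E k <= D ^+ 2.
  by move=> kK; have [mz Zz] := zP k kK; exact: (mean_sqr_dist_itv P Z F).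
have step (k : 'I_K) :
    \sum_j (h j + 6 * D * e) * (theta k / S * fine (P (A k j))) <=
    S^-1 * (2 * (theta k * (E k - E k.+1)) + 4 * c / rho * (theta k / k.+1%:R)
            + 12 * D * e * theta k).
  have [mX ZX] := zP k (ltnW (ltn_ord k)).
  have [mY ZY] := zP k.+1 (ltn_ord k).
  have [xi_prox xi_est] := xiP k (ltn_ord k).
  have := expected_residual_step P Z F rho D zbar zs rho0 Fmon ZD zsP zbarP
    (z k) (z k.+1) (xi k.+1) (c / k.+1%:R) e mX ZX mY ZY xi_prox
    (fun y Zy => (xi_est y Zy).1) (fun y Zy => (xi_est y Zy).2)
    phi cc mphi Zc phic.
  have := sum_prob_fibers P (phi \o z k) (mA k).
  rewrite -/(E k) -/(E k.+1) => q1 hq.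
  have -> : \sum_j (h j + 6 * D * e) * (theta k / S * fine (P (A k j))) =
      theta k / S * (\sum_j h j * fine (P (A k j)) +
                     6 * D * e * \sum_j fine (P (A k j))).
    rewrite [X in _ + X]mulr_sumr -big_split /= mulr_sumr.
    by apply: eq_bigr => j _; ring.
  rewrite q1 mulr1.
  have tS : 0 <= theta k / S by rewrite divr_ge0 ?powR_ge0 // ltW.
  apply: le_trans (ler_wpM2l tS (lerD hq (lexx _))) _.
  by rewrite le_eqVlt; apply/orP; left; apply/eqP; field; rewrite !gt_eqF // ltr0n.
apply: le_trans (ler_sum _ (fun k _ => step k)) _.
rewrite -mulr_sumr !big_split /= -!mulr_sumr -/S.
(* The telescoping part contributes [K^alpha D^2] and the subroutine errors [K^alpha]; [KaS] turns
   the common factor [K^alpha / S] into [(alpha + 1) / K]. *)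
have t1 := sum_powR_telescope_le alpha E (D ^+ 2) K a1 E_itv.
have t2 := sum_powR_div_le alpha K a1.
have KaS : S^-1 * K%:R `^ alpha <= (alpha + 1) / K%:R.
  rewrite ler_pdivlMr // -mulrA ler_pdivrMl //.
  rewrite mulrC [S * _]mulrC; move: KS.
  by rewrite powRD ?powRr1 ?pnatr_eq0 ?implybT //; lra.
have cr : 0 <= 4 * c / rho by rewrite divr_ge0 ?mulr_ge0 // ltW.
have t3 := lerD (ler_wpM2l (ler0n R 2) t1) (ler_wpM2l cr t2).
have Si : 0 <= S^-1 by rewrite invr_ge0 ltW.
have t4 := ler_wpM2l Si t3.
have M0 : 0 <= 2 * D ^+ 2 + 4 * c / rho by rewrite addr_ge0 // mulr_ge0 ?sqr_ge0.
have t5 := ler_wpM2l M0 KaS.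
rewrite [S^-1 * (_ + 12 * D * e * S)]mulrDr.
have -> : S^-1 * (12 * D * e * S) = 12 * D * e by field; rewrite gt_eqF.
apply: lerD De; apply: le_trans t4 _.
have -> : S^-1 * (2 * (K%:R `^ alpha * D ^+ 2) +
                  4 * c / rho * K%:R `^ alpha) =
  (2 * D ^+ 2 + 4 * c / rho) * (S^-1 * K%:R `^ alpha) by ring.
apply: le_trans t5 _.
by rewrite le_eqVlt; apply/orP; left; apply/eqP; field; rewrite !gt_eqF.
Qed.
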